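(* For a given $k>0$, let $H_k=\nabla^2 f(x^k)$, let $D_k$ be the $L\times L$ diagonal matrix with diagonal entries $(D_k)_{ll}=(AH_k^{-1}A')_{ll}$, let $B_k=AH_k^{-1}A'-D_k$, and let $\bar B_k$ be the $L\times L$ diagonal matrix with diagonal entries $(\bar B_k)_{ii}=\sum_{j=1}^{L}(B_k)_{ij}$. Let $w(0)\in\mathbb{R}^L$ be an arbitrary initial vector and consider the sequence $\{w(t)\}$ generated by the iteration $$w(t+1)=(D_k+\bar B_k)^{-1}(\bar B_k-B_k)\,w(t)+(D_k+\bar B_k)^{-1}\bigl(-AH_k^{-1}\nabla f(x^k)\bigr)\qquad\text{for all } t\ge 0.$$ Then the spectral radius of the matrix $(D_k+\bar B_k)^{-1}(B_k-\bar B_k)$ is strictly bounded above by $1$, the sequence $\{w(t)\}$ converges as $t\to\infty$, and its limit is the solution $w$ of the linear system $$(AH_k^{-1}A')\,w=-AH_k^{-1}\nabla f(x^k).$$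
   Context: A network has a set of links $\mathcal L=\{1,\dots,L\}$ with capacities $c_l>0$ and a set of sources $\mathcal S=\{1,\dots,S\}$, each using a predetermined route (a set of links). Each source traverses at least one link, each link is used by at least one source, and the links form a connected graph. The routing matrix $R\in\mathbb{R}^{L\times S}$ has $R_{ij}=1$ if link $i$ is on the route of source $j$ and $R_{ij}=0$ otherwise. Put $A=[R\ \ I(L)]\in\mathbb{R}^{L\times(S+L)}$, where $I(L)$ is the identity matrix; $'$ denotes transpose. Each source $i$ has a utility function $U_i:\mathbb{R}_+\to\mathbb{R}$ that is strictly concave and monotonically nondecreasing on $(0,\infty)$, and $-U_i$ is self-concordant on $(0,\infty)$: a convex function $g$ of one real variable is self-concordant if it is three times continuously differentiable and $|g'''(x)|\le 2g''(x)^{3/2}$ for all $x$ in its domain. The barrier coefficient $\mu\ge 1$ is fixed and $$f(x)=-\sum_{i=1}^{S}U_i(x_i)-\mu\sum_{i=1}^{S+L}\log x_i$$ for $x\in\mathbb{R}^{S+L}$ with all components positive. The vector $x^k\in\mathbb{R}^{S+L}$ is the $k$-th primal iterate of the distributed inexact Newton method for minimizing $f(x)$ subject to $Ax=c$; it satisfies $Ax^k=c$ and has strictly positive components. The Hessian $H_k=\nabla^2 f(x^k)$ is diagonal with strictly positive diagonal entries. *)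

(* Defs.v *)
From HB Require Import structures.
From mathcomp Require Import all_boot all_order all_algebra.
From mathcomp Require Import all_classical all_reals all_analysis.
From mathcomp Require Import complex.

Set Implicit Arguments.
Unset Strict Implicit.
Unset Printing Implicit Defensive.

Import Order.TTheory GRing.Theory Num.Theory.
Import numFieldNormedType.Exports.

Local Open Scope classical_set_scope.
Local Open Scope ring_scope.

Definition routing_mx (R : realType) (L S : nat) (route : 'I_S -> {set 'I_L}) :
    'M[R]_(L, S) :=
  \matrix_(l, s) (l \in route s)%:R.

Definition constraint_mx (R : realType) (L S : nat)
    (route : 'I_S -> {set 'I_L}) : 'M[R]_(L, S + L) :=
  row_mx (routing_mx R route) 1%:M.

(* Link l joins the nodes src l and dst l of the network. The orientation of
   the links plays no role for connectedness. *)
Definition link_adj (V : finType) (L : nat) (src dst : 'I_L -> V) : rel V :=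
  fun u v => [exists l : 'I_L, ((src l == u) && (dst l == v))
                            || ((src l == v) && (dst l == u))].

Definition links_connected (V : finType) (L : nat) (src dst : 'I_L -> V) :=
  forall u v : V, connect (link_adj src dst) u v.

Definition strictly_concave_on (R : realType) (I : set R) (g : R -> R) :=
  forall x y t : R, I x -> I y -> x != y -> 0 < t -> t < 1 ->
    t * g x + (1 - t) * g y < g (t * x + (1 - t) * y).

Definition nondecreasing_on (R : realType) (I : set R) (g : R -> R) :=
  forall x y : R, I x -> I y -> x <= y -> g x <= g y.

(* Meant for open I, where the two-sided derivatives at a point of I depend
   only on the values of g on I. *)
Definition thrice_continuously_differentiable_on (R : realType) (I : set R)
    (g : R -> R) :=
  forall x : R, I x ->
    [/\ forall n : nat, (n < 3)%N -> derivable (derive1n n g) x 1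
      & {for x, continuous (derive1n 3 g)}].

Definition self_concordant_on (R : realType) (I : set R) (g : R -> R) :=
  [/\ @convex_function R R^o I g, thrice_continuously_differentiable_on I g
    & forall x : R, I x -> `|derive1n 3 g x| <= 2 * (derive1n 2 g x) `^ (3 / 2)].

(* f(x) = - sum_{i <= S} U_i(x_i) - mu sum_{i <= S+L} log x_i; the first S
   components of x are the source rates, the last L ones the slacks. *)
Definition barrier_objective (R : realType) (L S : nat) (U : 'I_S -> R -> R)
    (mu : R) (x : 'cV[R]_(S + L)) : R :=
  - (\sum_(i < S) U i (x (lshift L i) 0)) - mu * \sum_(i < S + L) ln (x i 0).

Definition partial_derivative (R : realType) (n : nat) (f : 'cV[R]_n -> R)
    (i : 'I_n) (x : 'cV[R]_n) : R :=
  'D_(delta_mx i 0 : 'cV[R]_n) f x.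

Definition gradient (R : realType) (n : nat) (f : 'cV[R]_n -> R)
    (x : 'cV[R]_n) : 'cV[R]_n :=
  \col_i partial_derivative f i x.

Definition hessian (R : realType) (n : nat) (f : 'cV[R]_n -> R)
    (x : 'cV[R]_n) : 'M[R]_n :=
  \matrix_(i, j) partial_derivative (partial_derivative f j) i x.

Definition diag_part (R : realType) (n : nat) (M : 'M[R]_n) : 'M[R]_n :=
  diag_mx (\row_i M i i).

Definition row_sum_mx (R : realType) (n : nat) (M : 'M[R]_n) : 'M[R]_n :=
  diag_mx (\row_i \sum_j M i j).

(* The eigenvalues are the complex ones; for n = 0 there is none and sup
   returns 0. *)
Definition spectral_radius (R : realType) (n : nat) (M : 'M[R]_n) : R :=
  sup [set r : R | exists2 z : R[i],
         eigenvalue (map_mx (real_complex R) M) z & r = ComplexField.Normc.normc z].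

(* Main.v *)
(* The objective is a sum of one-variable functions, so its Hessian is diagonal,
   with entries [- U'' + mu / x^2 > 0] or [mu / x^2 > 0]; hence
   [M = A H^-1 A'] is symmetric, entrywise nonnegative and, because [A]
   contains the identity, positive definite. Write [M = P - Q] with
   [P = D + Bbar] and [Q = Bbar - B]; then [P + Q] is positive definite too.
   If [u] is an eigenvector of the pencil [Q u = z P u], then
   [z = u* Q u / u* P u] is real, and [- P < Q < P] gives [|z| < 1].
   For convergence, the error [e] satisfies [e+ = e - d] with [P d = M e], and
   [e+' M e+ = e' M e - d' (P + Q) d]. The energies [e' M e] decrease to a
   limit, so [d' (P + Q) d], hence [d] and [e = M^-1 P d], tends to 0. *)

Require Import Defs.
From HB Require Import structures.
From mathcomp Require Import all_boot all_order all_algebra.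
From mathcomp Require Import all_classical all_reals all_analysis.
From mathcomp Require Import complex ring lra.

Set Implicit Arguments.
Unset Strict Implicit.
Unset Printing Implicit Defensive.

Import Order.TTheory GRing.Theory Num.Theory.
Import numFieldNormedType.Exports.

Local Open Scope classical_set_scope.
Local Open Scope ring_scope.

(** * Derivatives of separable functions and the Hessian of the barrier objective *)

Lemma partial_derivative_separable (R : realType) (n : nat)
    (phi : 'I_n -> R -> R) (i : 'I_n) (x : 'cV[R]_n) :
  partial_derivative (fun y : 'cV[R]_n => \sum_j phi j (y j 0)) i x =
  derive1 (phi i) (x i 0).
Proof.
rewrite /partial_derivative /derive /derive1.
set d := (fun _ : R => _); set d' := (fun _ : R => _).
(* All summands except the [i]-th cancel in the difference quotient, so the two quotients are the
   same function of the step and their limits agree, existing or not. *)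
suff -> : d = d' by [].
apply/funext => h; rewrite /d /d' /= (bigD1 i)//= [X in _ - X](bigD1 i)//=.
rewrite !mxE !eqxx.
rewrite (eq_bigr (fun j => phi j (x j 0))); last first.
  by move=> j /negbTE ij; rewrite !mxE ij/= mulr0 add0r.
by rewrite opprD addrACA subrr addr0 /= mulr1.
Qed.

Lemma hessian_separable (R : realType) (n : nat) (phi : 'I_n -> R -> R)
    (x : 'cV[R]_n) :
  hessian (fun y : 'cV[R]_n => \sum_j phi j (y j 0)) x =
  diag_mx (\row_i derive1n 2 (phi i) (x i 0)).
Proof.
apply/matrixP => i j; rewrite !mxE.
(* The [j]-th partial derivative is itself separable, with [derive1 (phi j)] as its only nonzero
   summand, so the first-order formula applies a second time. *)
set psi := fun k => if k == j then derive1 (phi j) else cst 0.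
rewrite (_ : partial_derivative _ j =
             (fun y : 'cV[R]_n => \sum_k psi k (y k 0))).
  rewrite partial_derivative_separable /psi; case: eqVneq => [->|_].
    by rewrite mulr1n.
  by rewrite derive1_cst mulr0n.
apply/funext => y; rewrite partial_derivative_separable (bigD1 j)//= /psi eqxx.
by rewrite big1 ?addr0// => k /negbTE ->.
Qed.

Lemma midpoint_convex (R : realType) (I : set R) (f : R -> R) (x y : R) :
  @convex_function R R^o I f -> I x -> I y ->
  f ((x + y) / 2) <= (f x + f y) / 2.
Proof.
move=> cf Ix Iy.
have h0 : 0 <= 2^-1 :> R by lra.
have h1 : 2^-1 <= 1 :> R by lra.
have : f (2^-1 * x + (1 - 2^-1) * y) <= 2^-1 * f x + (1 - 2^-1) * f y.
  exact: (cf (Itv01 h0 h1) x y (mem_set Ix) (mem_set Iy)).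
have -> : 2^-1 * x + (1 - 2^-1) * y = (x + y) / 2 by field.
suff -> : 2^-1 * f x + (1 - 2^-1) * f y = (f x + f y) / 2 by [].
by field.
Qed.

(** By contradiction: a negative second derivative at [x] stays negative on a ball around [x]. The
    mean value theorem on the two halves of an interval centred at [x] gives [c2 < x < c1], where
    midpoint convexity forces f'(c2) <= f'(c1). The mean value theorem for f' between [c2] and [c1]
    gives the opposite strict inequality. *)
Lemma convex_derive1n2_ge0 (R : realType) (I : set R) (f : R -> R) (x : R) :
  open I -> I x -> @convex_function R R^o I f ->
  thrice_continuously_differentiable_on I f -> 0 <= derive1n 2 f x.
Proof.
move=> oI Ix cf df; rewrite leNgt; apply/negP => f2x.
have f2c : {for x, continuous (derive1n 2 f)}.
  have [d2 _] := df x Ix.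
  have /derivable1_diffP := d2 2%N isT.
  exact: differentiable_continuous.
have : \forall y \near x, I y /\ derive1n 2 f y < 0.
  near=> y; split.
    by near: y; exact: open_nbhs_nbhs.
  near: y; exact: (cvgr_lt _ f2c).
move=> /nbhs_ballP[e /= e0 be].
have bI y : x - e < y < x + e -> I y /\ derive1n 2 f y < 0.
  move=> xy; apply: be; rewrite /ball/= distrC ltr_distl; lra.
have mvt n a b : (n < 2)%N -> x - e < a -> b < x + e -> a < b ->
    exists2 c, a < c < b &
      derive1n n f b - derive1n n f a = derive1n n.+1 f c * (b - a).
  move=> n2 ea be' ab.
  have dn y : x - e < y < x + e -> derivable (derive1n n f) y 1.
    by move=> /bI[Iy _]; have [d _] := df y Iy; exact: d (leqW n2).
  have [|||c] := @MVT R (derive1n n f) (derive1n n.+1 f) a b.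
  - exact: ab.
  - move=> y; rewrite in_itv/= => /andP[ay yb].
    apply: DeriveDef; last exact/esym/derive1E.
    by apply: dn; lra.
  - apply: derivable_within_continuous => y; rewrite in_itv/= => /andP[ay yb].
    apply: dn; lra.
  by rewrite in_itv/= => acb ?; exists c.
have [I1 _] := bI (x - e / 2) ltac:(lra).
have [I2 _] := bI (x + e / 2) ltac:(lra).
have := midpoint_convex cf I1 I2.
have -> : (x - e / 2 + (x + e / 2)) / 2 = x by field.
move=> fx.
have [|||c1 /andP[xc1 c1x] e1] := mvt 0%N x (x + e / 2) isT; [lra|lra|lra|].
have [|||c2 /andP[c2x xc2] e2] := mvt 0%N (x - e / 2) x isT; [lra|lra|lra|].
have c21 : c2 < c1 := lt_trans xc2 xc1.
have [|||c3 /andP[c23 c31] e3] := mvt 1%N c2 c1 isT; [lra|lra|lra|].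
have c3e : x - e < c3 < x + e by clear -c2x xc2 xc1 c1x c23 c31 e0; lra.
have [_ c30] := bI c3 c3e.
have : derive1n 1 f c1 - derive1n 1 f c2 < 0.
  by rewrite e3 pmulr_llt0// subr_gt0.
have : 0 <= (derive1n 1 f c1 - derive1n 1 f c2) * (e / 2).
  by clear -e1 e2 fx; move: e1 e2 fx => /= e1 e2 fx; lra.
by rewrite pmulr_lge0 ?divr_gt0// => /le_lt_trans/[apply]; rewrite ltxx.
Unshelve. all: by end_near. Qed.

Lemma derive1n2_log_barrier (R : realType) (g : R -> R) (mu t : R) :
  thrice_continuously_differentiable_on [set y | 0 < y] g -> 0 < t ->
  derive1n 2 (fun y => g y - mu * ln y) t = derive1n 2 g t + mu / t ^+ 2.
Proof.
move=> dg t0.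
have -> : (fun y => g y - mu * ln y) = g - mu \*: @ln R by [].
rewrite derive1nS derive1n1 derive1E.
(* The formula for the first derivative is established at positive points only; its validity near
   [t] is enough to differentiate once more. *)
rewrite (@near_eq_derive _ _ _ _ (derive1 g - mu \*: @GRing.inv R)); last first.
  near=> y.
  have y0 : 0 < y by near: y; exact: lt_nbhsr.
  have d0 : derivable g y 1 by have [d _] := dg y y0; exact: (d 0%N).
  have dl : is_derive y 1 (@ln R) y^-1 by exact: is_derive1_ln.
  have dm := is_deriveZ mu dl.
  rewrite derive1E (deriveB d0 (ex_derive (is_derive := dm))) -derive1E.
  by rewrite (derive_val (is_derive := dm)).
have d1 : derivable (derive1 g) t 1 by have [d _] := dg t t0; exact: (d 1%N).
have tn0 : t != 0 by rewrite gt_eqF.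
have did : derivable (id : R -> R) t 1 by exact: derivable_id.
have dv : derivable (@GRing.inv R) t 1 := derivableV tn0 did.
have dm : derivable (mu \*: @GRing.inv R) t 1 := derivableZ (k := mu) dv.
rewrite (deriveB d1 dm) (deriveZ mu dv) (deriveV tn0 did) derive_id.
rewrite derive1nS derive1n1 [in RHS]derive1E.
by congr (_ + _); rewrite /GRing.scale/= mulr1 mulrN opprK.
Unshelve. all: by end_near. Qed.

Lemma hessian_barrier_objective (R : realType) (L S : nat) (U : 'I_S -> R -> R)
    (mu : R) (x : 'cV[R]_(S + L)) :
  (forall i, self_concordant_on [set y | 0 < y] (fun y => - U i y)) ->
  0 < mu -> (forall i, 0 < x i 0) ->
  exists2 d : 'rV[R]_(S + L),
    hessian (barrier_objective (L := L) U mu) x = diag_mx d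
    & forall i, 0 < d 0 i.
Proof.
move=> scU mu0 x0.
(* Extending the negated utilities by zero to the slack coordinates makes the objective one
   separable sum. *)
pose g (i : 'I_(S + L)) : R -> R :=
  match fintype.split i with inl s => fun y => - U s y | inr _ => cst 0 end.
exists (\row_i derive1n 2 (fun y => g i y - mu * ln y) (x i 0)).
  rewrite -hessian_separable; congr (hessian _ x); apply/funext => y.
  rewrite /barrier_objective big_split/= sumrN -mulr_sumr; congr (_ - _).
  rewrite big_split_ord/= [X in _ = _ + X]big1 ?addr0; last first.
    by move=> l _; rewrite /g (unsplitK (inr l)).
  by rewrite -sumrN; apply: eq_bigr => s _; rewrite /g (unsplitK (inl s)).
have cst0 : derive1 (cst 0 : R -> R) = cst 0.
  by apply/funext => t; rewrite derive1_cst.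
move=> i; rewrite mxE derive1n2_log_barrier//; last first.
  rewrite /g; case: (fintype.split i) => [s|_]; first by have [] := scU s.
  move=> t _; split => [n _|].
    suff -> : derive1n n (cst 0 : R -> R) = cst 0 by exact: derivable_cst.
    by elim: n => // n; rewrite derive1nS => ->.
  by rewrite !derive1nS derive1n0 !cst0; exact: cst_continuous.
(* The barrier term is strictly positive, so a nonnegative second derivative of [g i] suffices: by
   convexity of [- U s] on a source, and trivially on a slack. *)
rewrite ltr_wpDl ?divr_gt0 ?exprn_gt0//.
rewrite /g; case: (fintype.split i) => [s|_]; last first.
  by rewrite !derive1nS derive1n0 !cst0.
have [cU dU _] := scU s.
by apply: convex_derive1n2_ge0 cU dU => //; exact: x0.
Qed.

(** * Bilinear forms and positive definite matrices *)

Definition mxform (R : nzRingType) (n : nat) (M : 'M[R]_n)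
    (u v : 'cV[R]_n) : R :=
  (u^T *m M *m v) 0 0.

Definition posdefmx (R : numDomainType) (n : nat) (M : 'M[R]_n) :=
  forall v, v != 0 -> 0 < mxform M v v.

Section bilinear_form.
Context (R : comNzRingType) (n : nat).
Implicit Types (M N : 'M[R]_n) (u v : 'cV[R]_n).

Lemma mxformDr M u v1 v2 : mxform M u (v1 + v2) = mxform M u v1 + mxform M u v2.
Proof. by rewrite /mxform !mulmxDr mxE. Qed.

Lemma mxformBl M u1 u2 v : mxform M (u1 - u2) v = mxform M u1 v - mxform M u2 v.
Proof. by rewrite /mxform linearB !mulmxBl !mxE. Qed.

Lemma mxformBr M u v1 v2 : mxform M u (v1 - v2) = mxform M u v1 - mxform M u v2.
Proof. by rewrite /mxform !mulmxBr !mxE. Qed.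

Lemma mxformZr M u a v : mxform M u (a *: v) = a * mxform M u v.
Proof. by rewrite /mxform -scalemxAr mxE. Qed.

Lemma mxformDm M N u v : mxform (M + N) u v = mxform M u v + mxform N u v.
Proof. by rewrite /mxform mulmxDr mulmxDl mxE. Qed.

Lemma mxformBm M N u v : mxform (M - N) u v = mxform M u v - mxform N u v.
Proof. by rewrite /mxform mulmxBr mulmxBl !mxE. Qed.

Lemma mxformC M u v : M^T = M -> mxform M u v = mxform M v u.
Proof.
move=> sM; rewrite /mxform -[in LHS](trmxK (u^T *m M *m v)) mxE.
by rewrite !trmx_mul trmxK sM mulmxA.
Qed.

Lemma mxform_diag (d : 'rV[R]_n) v :
  mxform (diag_mx d) v v = \sum_i d 0 i * v i 0 ^+ 2.
Proof.
rewrite /mxform mxE; apply: eq_bigr => i _.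
by rewrite mul_mx_diag !mxE; ring.
Qed.

Lemma mxformE M u v : mxform M u v = \sum_i \sum_j M i j * (u i 0 * v j 0).
Proof.
rewrite /mxform mxE exchange_big; apply: eq_bigr => j _ /=.
rewrite mxE mulr_suml; apply: eq_bigr => i _; rewrite !mxE; ring.
Qed.

End bilinear_form.

Section positive_definite.
Context (R : numFieldType) (n : nat).
Implicit Types (M N : 'M[R]_n).

Lemma posdefmx_ge0 M v : posdefmx M -> 0 <= mxform M v v.
Proof.
move=> pM; have [->|/pM/ltW//] := eqVneq v 0.
by rewrite /mxform mulmx0 mxE.
Qed.

(** A nonzero kernel vector [v] would give [mxform M v v = 0]. *)
Lemma posdefmx_unit M : posdefmx M -> M \in unitmx.
Proof.
move=> pM; rewrite -unitmx_tr -row_free_unit -kermx_eq0.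
apply/eqP/row_matrixP => i; rewrite row0; apply: contraTeq isT => kn0.
set v := (row i (kermx M^T))^T.
have Mv0 : M *m v = 0.
  by rewrite -[M *m v]trmxK trmx_mul trmxK -row_mul mulmx_ker row0 trmx0.
have := pM v; rewrite trmx_eq0 => /(_ kn0).
by rewrite /mxform -mulmxA Mv0 mulmx0 mxE ltxx.
Qed.

(** Adding the two forms cancels [N] and leaves twice the form of [M]. This is what makes [P]
    invertible in a splitting. *)
Lemma posdefmx_sum_half M N :
  posdefmx (M - N) -> posdefmx (M + N) -> posdefmx M.
Proof.
move=> pB pD v v0; have := addr_gt0 (pB v v0) (pD v v0).
rewrite mxformBm mxformDm addrACA addNr addr0 -mulr2n -mulr_natl.
by rewrite pmulr_rgt0// ltr0n.
Qed.

End positive_definite.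

Lemma mxform_cauchy_schwarz (R : realFieldType) (n : nat) (K : 'M[R]_n)
    (u v : 'cV[R]_n) : K^T = K -> posdefmx K ->
  mxform K u v ^+ 2 <= mxform K u u * mxform K v v.
Proof.
move=> sK pK; have [->|/pK u0] := eqVneq u 0.
  by rewrite /mxform trmx0 !mul0mx !mxE expr0n mul0r.
(* At this combination of [u] and [v], the form equals [mxform K u u] times the gap in the
   inequality, and [mxform K u u] is positive. *)
have := posdefmx_ge0 (mxform K u u *: v - mxform K u v *: u) pK.
have -> : mxform K (mxform K u u *: v - mxform K u v *: u)
    (mxform K u u *: v - mxform K u v *: u) =
    mxform K u u * (mxform K u u * mxform K v v - mxform K u v ^+ 2).
  rewrite mxformBl !mxformBr !mxformZr.
  rewrite (mxformC (_ *: v) _ sK) (mxformC (_ *: u) u sK).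
  rewrite (mxformC (_ *: v) _ sK) (mxformC (_ *: u) v sK) !mxformZr.
  rewrite (mxformC v u sK); ring.
by rewrite pmulr_rge0// subr_ge0.
Qed.

(* Cauchy-Schwarz against [K^-1 r^T]. *)
Lemma posdefmx_coercive (R : realFieldType) (n : nat) (K : 'M[R]_n)
    (r : 'rV[R]_n) : K^T = K -> posdefmx K ->
  exists2 C : R, 0 <= C & forall v, ((r *m v) 0 0) ^+ 2 <= C * mxform K v v.
Proof.
move=> sK pK; set u := (r *m invmx K)^T.
exists (mxform K u u); first exact: posdefmx_ge0.
move=> v; suff <- : mxform K u v = (r *m v) 0 0 by exact: mxform_cauchy_schwarz.
by rewrite /mxform /u trmxK mulmxKV// posdefmx_unit.
Qed.

(** * Complex eigenvalues and the spectral radius of a real matrix *)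

Lemma eigenvalue_real_complex (R : rcfType) (n : nat) (N : 'M[R]_n) (p q : R) :
  eigenvalue (map_mx (real_complex R) N) (Complex p q) ->
  exists a b : 'rV[R]_n, [/\ (a != 0) || (b != 0),
    a *m N = p *: a - q *: b & b *m N = q *: a + p *: b].
Proof.
case/eigenvalueP => v vN v0.
(* A real matrix acts separately on the real and imaginary parts of the eigenvector, a row vector
   here; this keeps the spectral argument within real forms. *)
exists (map_mx (@complex.Re R) v), (map_mx (@complex.Im R) v).
have reim k : (v *m map_mx (real_complex R) N) 0 k =
    Complex (\sum_j complex.Re (v 0 j) * N j k)
            (\sum_j complex.Im (v 0 j) * N j k).
  rewrite mxE; elim/big_rec3: _ => // j z x y _ ->; rewrite mxE.
  case: (v 0 j) => c d; apply/eqP.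
  by rewrite eq_complex/= !mulr0 subr0 add0r !eqxx.
split.
- apply: contraNT v0; rewrite negb_or !negbK.
  move=> /andP[/eqP/rowP a0 /eqP/rowP b0].
  apply/eqP/rowP => k; move: (a0 k) (b0 k); rewrite !mxE.
  by case: (v 0 k) => c d /= -> ->.
- apply/rowP => k; have := reim k; rewrite vN !mxE.
  case: (v 0 k) => c d /= [-> _]; apply: eq_bigr => j _; by rewrite mxE.
- apply/rowP => k; have := reim k; rewrite vN !mxE.
  case: (v 0 k) => c d /= [_ e]; rewrite addrC e.
  by apply: eq_bigr => j _; rewrite mxE.
Qed.

(** A supremum of moduli below [r] could still equal [r]; finiteness of the spectrum excludes this,
    the eigenvalues being the roots [s] of the characteristic polynomial. Positivity of [r] covers
    the empty spectrum, whose [sup] is 0. *)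
Lemma spectral_radius_lt (R : realType) (n : nat) (N : 'M[R]_n) (r : R) :
  0 < r ->
  (forall p q, eigenvalue (map_mx (real_complex R) N) (Complex p q) ->
    Num.sqrt (p ^+ 2 + q ^+ 2) < r) ->
  spectral_radius N < r.
Proof.
move=> r0 Nr; rewrite /spectral_radius; set E := [set _ | _].
have [->|/set0P E0] := eqVneq E set0; first by rewrite sup0.
have [s sE] := closed_field_poly_normal (char_poly (map_mx (real_complex R) N)).
(* The filter makes [m < r] immediate, with [0 < r] for the default value, and by hypothesis every
   eigenvalue passes it. *)
pose m := \big[Order.max/0]_(z <- s | ComplexField.Normc.normc z < r)
  ComplexField.Normc.normc z.
have mr : m < r.
  by rewrite /m; elim/big_ind: _ => // x y xr yr; rewrite gt_max xr.
apply: le_lt_trans mr; apply: ge_sup => // _ [z Nz ->].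
apply: (Order.TotalTheory.le_bigmax_seq 0 z
  (fun z => ComplexField.Normc.normc z < r) (@ComplexField.Normc.normc R)).
  move: Nz; rewrite eigenvalue_root_char sE.
  rewrite (monicP (char_poly_monic _)) scale1r.
  by rewrite root_prod_XsubC.
by case: z Nz => p q /Nr.
Qed.

(** * Spectral bound for a symmetric splitting *)

Section splitting.
Context (R : realType) (n : nat) (P Q : 'M[R]_n).
Hypotheses (sP : P^T = P) (sQ : Q^T = Q).
Hypotheses (pB : posdefmx (P - Q)) (pD : posdefmx (P + Q)).

Lemma spectral_radius_splitting : spectral_radius (invmx P *m Q) < 1.
Proof.
have pP := posdefmx_sum_half pB pD; have uP := posdefmx_unit pP.
apply: spectral_radius_lt => // p q.
case/eigenvalue_real_complex => a0 [b0 [ab0 aN bN]].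
(* Transposing the left eigenvector and applying [invmx P] gives a right eigenvector of the pencil:
   Q (a + i b) = (p + i q) P (a + i b). *)
pose a := invmx P *m a0^T; pose b := invmx P *m b0^T.
have Pa : P *m a = a0^T by rewrite mulKVmx.
have Pb : P *m b = b0^T by rewrite mulKVmx.
have ab : (a != 0) || (b != 0).
  by apply: contraTT ab0; rewrite !negb_or !negbK -(trmx_eq0 a0) -(trmx_eq0 b0)
    -Pa -Pb => /andP[/eqP-> /eqP->]; rewrite mulmx0 eqxx.
have tN (c : 'rV[R]_n) : Q *m (invmx P *m c^T) = (c *m (invmx P *m Q))^T.
  by rewrite !trmx_mul sQ trmx_inv sP mulmxA.
have Qa : Q *m a = P *m (p *: a - q *: b).
  by rewrite tN aN mulmxBr -!scalemxAr Pa Pb !linearD !linearN/= !linearZ.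
have Qb : Q *m b = P *m (q *: a + p *: b).
  by rewrite tN bN mulmxDr -!scalemxAr Pa Pb !linearD/= !linearZ.
have QP u c d : Q *m c = P *m d -> mxform Q u c = mxform P u d.
  by move=> cd; rewrite /mxform -!mulmxA cd.
have := QP a _ _ Qa; have := QP b _ _ Qa.
have := QP a _ _ Qb; have := QP b _ _ Qb.
rewrite !mxformBr !mxformDr !mxformZr (mxformC b a sP) (mxformC b a sQ).
move=> Qbb Qab Qba Qaa.
have pos K : posdefmx K -> 0 < mxform K a a + mxform K b b.
  move=> pK; case/orP: ab => /pK ?.
    by rewrite ltr_pwDl// posdefmx_ge0.
  by rewrite ltr_wpDl// posdefmx_ge0.
have := pos _ pP; have := pos _ pB; have := pos _ pD.
rewrite !mxformBm !mxformDm Qaa Qbb; set T := _ + mxform P b b => hD hB T0.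
(* The two expressions for the symmetric pairing of [a] and [b] under [Q] differ by [q] times [T],
   so the eigenvalue is real. *)
have q0 : q = 0.
  have /eqP : q * (mxform P a a + mxform P b b) = 0 by rewrite mulrDr; lra.
  by rewrite mulf_eq0 (gt_eqF T0) orbF => /eqP.
rewrite q0 expr0n addr0 sqrtr_sqr ltr_norml.
(* The forms of [Q] at [a] and [b] add up to [p] times [T], so those of [P + Q] and [P - Q] add up
   to (1 + p) T and (1 - p) T. *)
have h1 : 0 < (1 + p) * (mxform P a a + mxform P b b).
  by move: hD; rewrite q0; lra.
have h2 : 0 < (1 - p) * (mxform P a a + mxform P b b).
  by move: hB; rewrite q0; lra.
move: h1 h2; rewrite !pmulr_lgt0//; lra.
Qed.

End splitting.

(** * Convergence of the splitting iteration *)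

Lemma cvg_mx_coord (R : realFieldType) (T : Type) (F : set_system T) (m n : nat)
    (f : T -> 'M[R]_(m, n)) (l : 'M[R]_(m, n)) : Filter F ->
  (forall i j, f t i j @[t --> F] --> l i j) -> f @ F --> l.
Proof.
move=> FF fl; apply/cvg_ballP => e e0.
have : \forall t \near F,
    forall k : 'I_m * 'I_n, ball (l k.1 k.2) e (f t k.1 k.2).
  by apply: filter_forall => -[i j]; move/cvg_ballP: (fl i j) => /(_ e e0).
by apply: filterS => t flt; split=> // i j; exact: (flt (i, j)).
Qed.

Lemma sqr_cvg0 (R : realType) (u : nat -> R) :
  u t ^+ 2 @[t --> \oo] --> 0 -> u @ \oo --> 0.
Proof.
move=> u0; apply/norm_cvg0P.
have -> : (fun t => `|u t|) = (fun t => Num.sqrt (u t ^+ 2)).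
  by apply/funext => t; rewrite sqrtr_sqr.
rewrite -[X in _ --> X]sqrtr0; apply: continuous_cvg u0; exact: sqrt_continuous.
Qed.

Section splitting_convergence.
Context (R : realType) (n : nat) (P Q : 'M[R]_n).
Hypotheses (sP : P^T = P) (sQ : Q^T = Q).
Hypotheses (pB : posdefmx (P - Q)) (pD : posdefmx (P + Q)).

Let M := P - Q.
Let sM : M^T = M. Proof. by rewrite linearB/= sP sQ. Qed.

(* [e - d] is [P^-1 Q e], the next error of the iteration. *)
Lemma splitting_energy (e : 'cV[R]_n) (d := invmx P *m M *m e) :
  mxform M (e - d) (e - d) = mxform M e e - mxform (P + Q) d d.
Proof.
have uP := posdefmx_unit (posdefmx_sum_half pB pD).
have Pd : P *m d = M *m e by rewrite /d -mulmxA mulKVmx.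
have MP : mxform M d e = mxform P d d by rewrite /mxform -!mulmxA Pd.
rewrite mxformBl !mxformBr (mxformC e d sM) MP.
rewrite (mxformDm P Q) (mxformBm P Q d d : mxform M d d = _); ring.
Qed.

Lemma splitting_cvg0 (e : nat -> 'cV[R]_n) :
  (forall t, e t.+1 = invmx P *m Q *m e t) -> e @ \oo --> (0 : 'cV[R]_n).
Proof.
move=> eS; have uP := posdefmx_unit (posdefmx_sum_half pB pD).
have uM := posdefmx_unit pB.
pose d t := invmx P *m M *m e t.
have ed t : e t.+1 = e t - d t.
  by rewrite eS /d mulmxBr mulVmx// mulmxBl mul1mx subKr.
pose E t := mxform M (e t) (e t).
pose F t := mxform (P + Q) (d t) (d t).
have EF t : F t = E t - E t.+1.
  by rewrite /E ed splitting_energy; rewrite /F; ring.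
have cE : cvgn E.
  apply: nonincreasing_is_cvgn.
    apply/nonincreasing_seqP => t; rewrite -subr_ge0 -EF; exact: posdefmx_ge0.
  by exists 0 => _ [t _ <-]; exact: posdefmx_ge0.
(* [F] is the sequence of consecutive differences of the convergent sequence [E]. *)
have F0 : F @ \oo --> 0.
  rewrite (_ : F = fun t => E t - E t.+1); last exact/funext.
  rewrite -(subrr (limn E)); apply: cvgB => //.
  by rewrite (cvg_shiftS E).
apply: cvg_mx_coord => i j; rewrite mxE (ord1 j).
(* Since [e t] is [invmx M *m P *m d t], each coordinate of the error is a fixed row [r] applied to
   [d t]; coercivity of [P + Q] then bounds its square by a multiple of [F t]. *)
pose r : 'rV[R]_n := row i (invmx M *m P).
have [|C C0 rC] := posdefmx_coercive r _ pD; first by rewrite linearD/= sP sQ.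
have re t : e t i 0 = (r *m d t) 0 0.
  rewrite /r -row_mul [RHS]mxE /d !mulmxA -(mulmxA _ P) mulmxV// mulmx1.
  by rewrite mulVmx// mul1mx.
apply: sqr_cvg0.
apply: (@squeeze_cvgr _ _ _ _ (cst 0) (fun t => C * F t)).
- by near=> t; rewrite sqr_ge0 re rC.
- exact: cvg_cst.
- by rewrite -[X in _ --> X](mulr0 C); apply: cvgMr.
Unshelve. all: by end_near. Qed.

(** The proposed limit is a fixed point of the affine iteration, so the difference from it follows
    the homogeneous one. *)
Lemma splitting_cvg (b : 'cV[R]_n) (w : nat -> 'cV[R]_n) :
  (forall t, w t.+1 = invmx P *m Q *m w t + invmx P *m b) ->
  w @ \oo --> invmx M *m b.
Proof.
move=> wS; have uP := posdefmx_unit (posdefmx_sum_half pB pD).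
set l := invmx M *m b.
have lfix : l = invmx P *m Q *m l + invmx P *m b.
  have <- : M *m l = b by rewrite mulKVmx// posdefmx_unit.
  rewrite -mulmxA -mulmxDr -mulmxDl /M addrC subrK mulmxA.
  by rewrite mulVmx// mul1mx.
have e0 : (fun t => w t - l) @ \oo --> (0 : 'cV[R]_n).
  apply: splitting_cvg0 => t.
  by rewrite wS {1}lfix opprD addrACA subrr addr0 mulmxBr.
rewrite -[l]add0r (_ : w = fun t => (w t - l) + l).
  by apply: cvgD e0 _; exact: cvg_cst.
by apply/funext => t; rewrite subrK.
Qed.

End splitting_convergence.

(** * Positive definiteness of the diagonal and row-sum splitting *)

Lemma posdefmx_diag (R : realFieldType) (n : nat) (d : 'rV[R]_n) :
  (forall i, 0 < d 0 i) -> posdefmx (diag_mx d).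
Proof.
move=> d0 v /cV0Pn[i vi]; rewrite mxform_diag (bigD1 i)//= ltr_wpDr//.
  by apply: sumr_ge0 => j _; rewrite mulr_ge0 ?sqr_ge0// ltW.
by rewrite mulr_gt0// lt_neqAle eq_sym sqrf_eq0 vi sqr_ge0.
Qed.

(** The form at [v] is the form of [K] at [A^T *m v], a nonzero vector by injectivity. *)
Lemma posdefmx_congr (R : realFieldType) (m n : nat) (A : 'M[R]_(m, n))
    (K : 'M[R]_n) :
  (forall v : 'cV[R]_m, A^T *m v = 0 -> v = 0) ->
  posdefmx K -> posdefmx (A *m K *m A^T).
Proof.
move=> injA pK v v0; have /pK : A^T *m v != 0.
  by apply: contra_neq v0 => /injA.
by rewrite /mxform trmx_mul trmxK !mulmxA.
Qed.

Lemma invmx_diag (F : fieldType) (n : nat) (d : 'rV[F]_n) :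
  (forall i, d 0 i != 0) -> invmx (diag_mx d) = diag_mx (\row_i (d 0 i)^-1).
Proof.
move=> d0; have dV : diag_mx d *m diag_mx (\row_i (d 0 i)^-1) = 1%:M.
  rewrite mulmx_diag -diag_const_mx; congr diag_mx.
  by apply/rowP => i; rewrite !mxE mulfV.
have [ud _] := mulmx1_unit dV.
by rewrite -[LHS]mulmx1 -dV mulKmx.
Qed.

Section laplacian_splitting.
Context (R : realType) (n : nat) (M : 'M[R]_n).
Let D := diag_part M.
Let B := M - D.
(** For symmetric, entrywise nonnegative [M], the matrix [Bbar - B] is the Laplacian of the graph
    weighted by [B]. *)
Let Bbar := row_sum_mx B.

Lemma laplacian_splittingB : D + Bbar - (Bbar - B) = M.
Proof. by rewrite opprB addrACA subrr addr0 subrKC. Qed.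

Hypothesis sM : M^T = M.

Lemma tr_laplacian_splitting :
  (D + Bbar)^T = D + Bbar /\ (Bbar - B)^T = Bbar - B.
Proof.
by rewrite linearD linearB/= linearB/= sM /Bbar /D !tr_diag_mx.
Qed.

Hypotheses (M_ge0 : forall i j, 0 <= M i j) (pM : posdefmx M).

(* [D + 2 Bbar - B] is [D] plus a form with coefficients
   [B i j * (v i ^ 2 + v j ^ 2 - v i * v j)] after symmetrization. *)
Lemma posdefmx_laplacian_splittingD : posdefmx (D + Bbar + (Bbar - B)).
Proof.
move=> v v0; rewrite -addrA mxformDm.
have D_gt0 : 0 < mxform D v v.
  apply: posdefmx_diag v0 => i; rewrite mxE.
  have /pM : delta_mx i 0 != 0 :> 'cV[R]_n.
    by apply/cV0Pn; exists i; rewrite mxE !eqxx oner_neq0.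
  by rewrite /mxform trmx_delta -rowE -colE !mxE.
rewrite ltr_wpDr// mxformDm mxformBm.
have BbarE : mxform Bbar v v = \sum_i \sum_j B i j * v i 0 ^+ 2.
  by rewrite mxform_diag; apply: eq_bigr => i _; rewrite mxE mulr_suml.
(* By symmetry of [B] the square may sit on either index; one copy of [Bbar] is written each way to
   pair the squares of [v i 0] and [v j 0]. *)
have BbarE' : mxform Bbar v v = \sum_i \sum_j B i j * v j 0 ^+ 2.
  rewrite BbarE exchange_big; apply: eq_bigr => j _; apply: eq_bigr => i _ /=.
  by congr (_ * _); rewrite -[B in LHS]trmxK mxE /B linearB/= sM tr_diag_mx.
rewrite {1}BbarE BbarE' mxformE addrA -big_split/= -sumrB.
apply: sumr_ge0 => i _; rewrite -big_split/= -sumrB.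
apply: sumr_ge0 => j _; rewrite -mulrDr -mulrBr mulr_ge0//.
  rewrite !mxE; case: eqVneq => [->|_]; first by rewrite mulr1n subrr.
  by rewrite mulr0n subr0.
nra.
Qed.

End laplacian_splitting.

(** * The constraint matrix and the network iteration *)

Lemma constraint_mx_tr_inj (R : realType) (L S : nat)
    (route : 'I_S -> {set 'I_L}) (v : 'cV[R]_L) :
  (constraint_mx R route)^T *m v = 0 -> v = 0.
Proof.
(* The identity block makes [v] itself the lower block of the product. *)
rewrite /constraint_mx tr_row_mx mul_col_mx trmx1 mul1mx => /eqP.
by rewrite col_mx_eq0 => /andP[_ /eqP].
Qed.

Lemma constraint_mx_ge0 (R : realType) (L S : nat)
    (route : 'I_S -> {set 'I_L}) i j : 0 <= constraint_mx R route i j.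
Proof.
by rewrite mxE; case: (fintype.split j) => k; rewrite mxE ler0n.
Qed.

Theorem theorem4p3 (R : realType) (L S : nat)
    (V : finType) (src dst : 'I_L -> V) (c : 'cV[R]_L)
    (route : 'I_S -> {set 'I_L}) (U : 'I_S -> R -> R) (mu : R)
    (x : nat -> 'cV[R]_(S + L)) :
  (forall l, 0 < c l 0) ->
  (forall s, exists l, l \in route s) ->
  (forall l, exists s, l \in route s) ->
  links_connected src dst ->
  (forall i, strictly_concave_on [set y | 0 < y] (U i)) ->
  (forall i, nondecreasing_on [set y | 0 < y] (U i)) ->
  (forall i, self_concordant_on [set y | 0 < y] (fun y => - U i y)) ->
  1 <= mu ->
  let A := constraint_mx R route in
  let f := barrier_objective (L := L) U mu in
  (forall k, A *m x k = c) ->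
  (forall k i, 0 < x k i 0) ->
  forall k : nat, (0 < k)%N ->
  let H := hessian f (x k) in
  let M := A *m invmx H *m A^T in
  let D := diag_part M in
  let B := M - D in
  let Bbar := row_sum_mx B in
  let b := - (A *m invmx H *m gradient f (x k)) in
  forall w : nat -> 'cV[R]_L,
  (forall t, w t.+1 = invmx (D + Bbar) *m (Bbar - B) *m w t
                      + invmx (D + Bbar) *m b) ->
  spectral_radius (invmx (D + Bbar) *m (B - Bbar)) < 1 /\
  exists wlim : 'cV[R]_L,
    [/\ w t @[t --> \oo] --> wlim,
        M *m wlim = b
      & forall v : 'cV[R]_L, M *m v = b -> v = wlim].
Proof.
move=> _ _ _ _ _ _ scU mu1 A f _ x0 k _ H M D B Bbar b w wS.
have [d Hd d0] := hessian_barrier_objective scU (lt_le_trans ltr01 mu1) (x0 k).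
have HV : invmx H = diag_mx (\row_i (d 0 i)^-1).
  by rewrite /H Hd invmx_diag// => i; rewrite gt_eqF.
have sM : M^T = M by rewrite /M HV !trmx_mul trmxK tr_diag_mx mulmxA.
have pM : posdefmx M.
  apply: posdefmx_congr; first exact: constraint_mx_tr_inj.
  by rewrite HV; apply: posdefmx_diag => i; rewrite mxE invr_gt0.
have M_ge0 i j : 0 <= M i j.
  rewrite /M HV mxE; apply: sumr_ge0 => l _.
  rewrite [A^T _ _]mxE mulr_ge0 ?constraint_mx_ge0//.
  rewrite mul_mx_diag [X in 0 <= X]mxE mulr_ge0 ?constraint_mx_ge0//.
  by rewrite mxE invr_ge0 ltW.
have PQ : D + Bbar - (Bbar - B) = M := laplacian_splittingB M.
have [sP sQ] : (D + Bbar)^T = D + Bbar /\ (Bbar - B)^T = Bbar - B.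
  exact: tr_laplacian_splitting.
have pB : posdefmx (D + Bbar - (Bbar - B)) by rewrite PQ.
have pD : posdefmx (D + Bbar + (Bbar - B)).
  exact: posdefmx_laplacian_splittingD.
split.
  (* [B - Bbar] is the negative of the [Q] of the splitting. Negating [Q] exchanges [P - Q] and
     [P + Q], both positive definite, so the spectral bound still applies. *)
  rewrite -opprB; apply: spectral_radius_splitting => //.
  - by rewrite linearN/= sQ.
  - by rewrite opprK.
have uM := posdefmx_unit pM.
exists (invmx M *m b); split.
- by rewrite -[in X in _ --> X]PQ; exact: splitting_cvg wS.
- by rewrite mulKVmx.
- by move=> v <-; rewrite mulKmx.
Qed.
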